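(* Let $\Gamma \subset \mathbb{H} \rtimes S^1$ be a Heisenberg Bieberbach group satisfying $\mathrm{pr}_2(\Gamma) = \langle i \rangle$. Put $\Lambda = \Gamma \cap \mathbb{H}$, $N = \#(Z(\Lambda)/[\Lambda,\Lambda])$ and $c = 4/N$. Then $N$ must be even and $\Gamma$ is conjugate in $\mathbb{H}\rtimes\mathbb{C}^*$ to either $$\Gamma_c := \langle \Lambda_{i,c},\ \psi := (0,c/4)\,\mu(i)\rangle \quad\text{or}\quad \Gamma_c' := \langle \Lambda_{i,c},\ \psi' := (0,3c/4)\,\mu(i)\rangle.$$
   Context: The Heisenberg group is $\mathbb{H} = \mathbb{C}\times\mathbb{R}$ with multiplication $(z,t)\cdot(z',t') = (z+z', t+t'+2\operatorname{Im}(z\bar z'))$. For $\lambda \in \mathbb{C}^*$ let $\mu(\lambda)(z,t) = (\lambda z, |\lambda|^2 t)$. The group $\mathbb{H}\rtimes\mathbb{C}^*$ is the set $\mathbb{H}\times\mathbb{C}^*$ with $(g,\lambda)\cdot(h,\nu) = (g\cdot\mu(\lambda)(h), \lambda\nu)$; it acts on $\mathbb{H}$ from the left by $(g,\lambda)h = g\cdot\mu(\lambda)(h)$, and $(g,\lambda)$ is also written $g\,\mu(\lambda)$. $\mathbb{H}$ is regarded as the subgroup of elements $(g,1)$, $\mathbb{H}\rtimes S^1$ is the subgroup of elements $(g,\lambda)$ with $|\lambda|=1$, and $\mathrm{pr}_2: \mathbb{H}\rtimes\mathbb{C}^*\to\mathbb{C}^*$ is the second projection. A Heisenberg Bieberbach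 group is a discrete torsion-free subgroup $\Gamma\subset\mathbb{H}\rtimes S^1$ such that $\Gamma\backslash\mathbb{H}$ is compact; then $\Lambda=\Gamma\cap\mathbb{H}$ is a lattice (co-compact discrete subgroup) in $\mathbb{H}$, and $Z(\Lambda)/[\Lambda,\Lambda]$ is finite, where $Z(\Lambda)$ denotes the center and $[\Lambda,\Lambda]$ the commutator subgroup. For $\tau\in\mathbb{C}$ and $c>0$ with $4\operatorname{Im}\tau/c\in\mathbb{Z}_{>0}$, $\Lambda_{\tau,c} := \langle (1,0),(\tau,0),(0,c)\rangle \subset \mathbb{H}$; here $\tau = i$. Angle brackets denote the subgroup generated. *)

(* Defs.v *)
From HB Require Import structures.
From mathcomp Require Import all_boot all_order all_algebra.
From mathcomp Require Import generic_quotient complex finmap ring.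
From mathcomp Require Import all_classical all_reals all_analysis.

Set Implicit Arguments.
Unset Strict Implicit.
Unset Printing Implicit Defensive.

Import Order.TTheory GRing.Theory Num.Theory.
Import numFieldNormedType.Exports.

Local Open Scope classical_set_scope.
Local Open Scope ring_scope.
Local Open Scope complex_scope.

Section Subgroups.
Variable G : groupType.
Implicit Types A B : set G.

Definition generated A : set G :=
  [set x | forall K : groupClosed G, A `<=` [set` K] -> x \in K].

Definition center_of A : set G := [set x | A x /\ forall y, A y -> commute x y].

Definition commutator_subgroup A : set G :=
  generated [set u | exists x y, [/\ A x, A y & u = [~ x, y]%g]].

Definition left_cosets A B : set (set G) :=
  [set [set (x * b)%g | b in B] | x in A].

(* [fset_set] sends infinite sets to the empty one, so the value is [0] when
   the quotient is infinite. *)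
Definition quotient_card A B : nat := #|` fset_set (left_cosets A B)|.

Definition torsion_free A : Prop :=
  forall x n, A x -> (0 < n)%N -> (x ^+ n)%g = 1%g -> x = 1%g.

Definition conjugate A B : Prop := exists x, [set (a ^ x)%g | a in A] = B.

End Subgroups.

Definition discrete_subset (T : topologicalType) (A : set T) : Prop :=
  A `<=` isolated A.

HB.instance Definition _ (R : realType) :=
  PseudoPointedMetric.copy R[i] R[i]^o.
HB.instance Definition _ (R : realType) := NormedModule.copy R[i] R[i]^o.

Section Cstar.
Variable R : realType.

Record cstar := Cstar { cval :> R[i]; cval_neq0 : cval != 0 }.

HB.instance Definition _ := [isSub for cval].
HB.instance Definition _ := [Choice of cstar by <:].
HB.instance Definition _ := Topological.copy cstar (initial_topology cval).

Definition cstar_one : cstar := Cstar (oner_neq0 _).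
Definition cstar_mul (x y : cstar) : cstar :=
  Cstar (mulf_neq0 (cval_neq0 x) (cval_neq0 y)).
Definition cstar_inv (x : cstar) : cstar := Cstar (invr_neq0 (cval_neq0 x)).

Fact cstar_mulA : associative cstar_mul.
Proof. by move=> x y z; apply: val_inj; rewrite /= mulrA. Qed.
Fact cstar_mul1 : left_id cstar_one cstar_mul.
Proof. by move=> x; apply: val_inj; rewrite /= mul1r. Qed.
Fact cstar_mulr1 : right_id cstar_one cstar_mul.
Proof. by move=> x; apply: val_inj; rewrite /= mulr1. Qed.
Fact cstar_mulV : left_inverse cstar_one cstar_inv cstar_mul.
Proof. by move=> x; apply: val_inj; rewrite /= mulVf// cval_neq0. Qed.
Fact cstar_mulrV : right_inverse cstar_one cstar_inv cstar_mul.
Proof. by move=> x; apply: val_inj; rewrite /= mulfV// cval_neq0. Qed.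

HB.instance Definition _ := isGroup.Build cstar
  cstar_mulA cstar_mul1 cstar_mulr1 cstar_mulV cstar_mulrV.

Fact i_neq0 : 'i != 0 :> R[i].
Proof. by rewrite eq_complex /= oner_eq0 andbF. Qed.

Definition cstar_i : cstar := Cstar i_neq0.

End Cstar.

Section Heisenberg.
Variable R : realType.

Record heis := Heis { hz : R[i]; ht : R }.

Definition heis_pair (g : heis) : R[i] * R := (hz g, ht g).
Definition pair_heis (p : R[i] * R) : heis := Heis p.1 p.2.

Fact heis_pairK : cancel heis_pair pair_heis.
Proof. by case. Qed.

HB.instance Definition _ := Choice.copy heis (can_type heis_pairK).
HB.instance Definition _ := Topological.copy heis (initial_topology heis_pair).

Definition heis_one : heis := Heis 0 0.
Definition heis_mul (g h : heis) : heis :=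
  Heis (hz g + hz h) (ht g + ht h + 2 * complex.Im (hz g * (hz h)^*)).
Definition heis_inv (g : heis) : heis := Heis (- hz g) (- ht g).

Fact heis_mulA : associative heis_mul.
Proof.
move=> [[a b] s] [[c d] t] [[e f] u]; congr Heis => /=; first by rewrite addrA.
by ring.
Qed.
Fact heis_mul1 : left_id heis_one heis_mul.
Proof.
by move=> [[a b] s]; congr Heis => /=; [rewrite add0r | ring].
Qed.
Fact heis_mulr1 : right_id heis_one heis_mul.
Proof.
by move=> [[a b] s]; congr Heis => /=; [rewrite addr0 | ring].
Qed.
Fact heis_mulV : left_inverse heis_one heis_inv heis_mul.
Proof.
by move=> [[a b] s]; congr Heis => /=; [rewrite addNr | ring].
Qed.
Fact heis_mulrV : right_inverse heis_one heis_inv heis_mul.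
Proof.
by move=> [[a b] s]; congr Heis => /=; [rewrite addrN | ring].
Qed.

HB.instance Definition _ := isGroup.Build heis
  heis_mulA heis_mul1 heis_mulr1 heis_mulV heis_mulrV.

Definition mu (l : cstar R) (g : heis) : heis :=
  Heis (val l * hz g) (Normc.normc (val l) ^+ 2 * ht g).

Fact normc_sqr (z : R[i]) :
  Normc.normc z ^+ 2 = complex.Re z ^+ 2 + complex.Im z ^+ 2.
Proof. by case: z => a b; rewrite /= sqr_sqrtr// addr_ge0// sqr_ge0. Qed.

Fact muM l : {morph mu l : g h / (g * h)%g}.
Proof.
case: l => [l l0] [[a b] s] [[c d] t]; congr Heis; first exact: mulrDr.
by rewrite /mu normc_sqr /=; case: l {l0} => p q /=; ring.
Qed.

Fact mu1 g : mu 1%g g = g.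
Proof. by case: g => z t; rewrite /mu Normc.normc1 expr1n !mul1r. Qed.

Fact mu_mul l m g : mu (l * m)%g g = mu l (mu m g).
Proof.
case: l m g => [l l0] [m m0] [z t]; congr Heis; first exact/esym/mulrA.
by rewrite /mu !normc_sqr /=; case: l m {l0 m0} => [p q] [u v] /=; ring.
Qed.

(* The semidirect product of the Heisenberg group by the dilations [mu];
   [HeisC g l] is the element written g mu(l). *)
Record heisC := HeisC { pr1 : heis; pr2 : cstar R }.

Definition heisC_pair (x : heisC) : heis * cstar R := (pr1 x, pr2 x).
Definition pair_heisC (p : heis * cstar R) : heisC := HeisC p.1 p.2.

Fact heisC_pairK : cancel heisC_pair pair_heisC.
Proof. by case. Qed.

HB.instance Definition _ := Choice.copy heisC (can_type heisC_pairK).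
HB.instance Definition _ :=
  Topological.copy heisC (initial_topology heisC_pair).

Definition heisC_act (x : heisC) (h : heis) : heis := (pr1 x * mu (pr2 x) h)%g.

Definition heisC_one : heisC := HeisC 1%g 1%g.
Definition heisC_mul (x y : heisC) : heisC :=
  HeisC (heisC_act x (pr1 y)) (pr2 x * pr2 y)%g.
Definition heisC_inv (x : heisC) : heisC :=
  HeisC (mu (pr2 x)^-1%g (pr1 x)^-1%g) (pr2 x)^-1%g.

Fact mug1 l : mu l 1%g = 1%g.
Proof. by congr Heis; rewrite /= mulr0. Qed.

Fact heisC_mulA : associative heisC_mul.
Proof.
move=> x y z; rewrite /heisC_mul /heisC_act /=.
by rewrite muM mu_mul !mulgA.
Qed.
Fact heisC_mul1 : left_id heisC_one heisC_mul.
Proof. by case=> g l; rewrite /heisC_mul /heisC_act /= mu1 !mul1g. Qed.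
Fact heisC_mulr1 : right_id heisC_one heisC_mul.
Proof. by case=> g l; rewrite /heisC_mul /heisC_act /= mug1 !mulg1. Qed.
Fact heisC_mulV : left_inverse heisC_one heisC_inv heisC_mul.
Proof.
by case=> g l; rewrite /heisC_mul /heisC_act /= -muM !mulVg mug1.
Qed.
Fact heisC_mulrV : right_inverse heisC_one heisC_inv heisC_mul.
Proof.
by case=> g l; rewrite /heisC_mul /heisC_act /= -mu_mul !mulgV mu1 mulgV.
Qed.

HB.instance Definition _ := isGroup.Build heisC
  heisC_mulA heisC_mul1 heisC_mulr1 heisC_mulV heisC_mulrV.

Fact heisC_act1 h : heisC_act 1%g h = h.
Proof. by rewrite /heisC_act mu1 mul1g. Qed.

Fact heisC_actM x y h : heisC_act (x * y)%g h = heisC_act x (heisC_act y h).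
Proof. by rewrite /heisC_act /= mu_mul muM mulgA. Qed.

Definition heis_incl (g : heis) : heisC := HeisC g 1%g.

Section Orbits.
Variable Gamma : groupClosed heisC.

Definition same_orbit (g h : heis) : bool :=
  `[< exists2 x, x \in Gamma & g = heisC_act x h >].

Fact same_orbit_refl : reflexive same_orbit.
Proof.
by move=> g; apply/asboolP; exists 1%g; rewrite ?heisC_act1// gpred1.
Qed.

Fact same_orbit_sym : symmetric same_orbit.
Proof.
suff sym g h : same_orbit g h -> same_orbit h g.
  by move=> g h; apply/idP/idP; exact: sym.
move=> /asboolP[x xG ->]; apply/asboolP; exists x^-1%g; rewrite ?gpredV//.
by rewrite -heisC_actM mulVg heisC_act1.
Qed.

Fact same_orbit_trans : transitive same_orbit.
Proof.
move=> h g k /asboolP[x xG ->] /asboolP[y yG ->]; apply/asboolP.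
by exists (x * y)%g; rewrite ?gpredM// heisC_actM.
Qed.

Canonical same_orbit_equiv :=
  EquivRel same_orbit same_orbit_refl same_orbit_sym same_orbit_trans.

Definition orbit_space := quotient_topology {eq_quot same_orbit}%qT.

End Orbits.

Record heisenberg_bieberbach (Gamma : groupClosed heisC) : Prop := {
  bieberbach_unitary : forall x, x \in Gamma -> `|val (pr2 x)| = 1;
  bieberbach_discrete : discrete_subset [set` Gamma];
  bieberbach_torsion_free : torsion_free [set` Gamma];
  bieberbach_cocompact : compact [set: orbit_space Gamma] }.

Definition heis_part (Gamma : groupClosed heisC) : set heisC :=
  [set` Gamma] `&` range heis_incl.

Definition heis_lattice (tau : R[i]) (c : R) : set heis :=
  generated [set Heis 1 0; Heis tau 0; Heis 0 c].

Definition bieberbach_model (c : R) : set heisC :=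
  generated (heis_incl @` heis_lattice 'i c
             `|` [set HeisC (Heis 0 (c / 4)) (cstar_i R)]).

Definition bieberbach_model' (c : R) : set heisC :=
  generated (heis_incl @` heis_lattice 'i c
             `|` [set HeisC (Heis 0 (3 * c / 4)) (cstar_i R)]).

End Heisenberg.

(* Main.v *)
From HB Require Import structures.
Require Import Defs.
From mathcomp Require Import all_boot all_order all_algebra.
From mathcomp Require Import generic_quotient complex ring lra zify.
From mathcomp Require Import all_classical all_reals all_analysis.

(** A conjugation puts the group into a normal form that can be read off.

    An element of Gamma with rotation part i acts on the plane C as a rotation
    with a single fixed point p.  Conjugating by the translation by p turns it
    into a screw motion psi = (0, t0) mu(i).  Let G be the conjugated group,
    Lambda its Heisenberg part and Z = {t | (0, t) in Lambda}.  The group Z is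
    discrete, and psi^4 = (0, 4 t0) is not 1 because G is torsion-free, so
    Z = cZ for some c > 0.

    Everything else comes from one obstruction (screw_obstruction): for every
    (w, s) in Lambda, the square of (w, s) psi^2 is (0, 2 s + 4 t0), which is
    not 1.  With w = 0 it says that 4 t0 is an odd multiple of c.
    Conjugating (w, t) twice by psi gives (-w, t), and the product of the two
    is (0, 2 t), so t is in (c / 2) Z; the obstruction excludes the odd
    multiples of c / 2.  Hence Lambda is the set L x cZ, with no twisting left
    between the plane and the center (height_lattice).

    The set L is then a discrete subgroup of C stable under i.  It is not 0,
    since otherwise |z| would be a G-invariant function, unbounded on a
    compact orbit space (cocompact_unbounded, noncentral_of_unbounded).  So
    division with remainder gives L = al Z[i] (discrete_subgroup_gaussian),
    and the dilation mu(al) makes L equal to Z[i] (normal_form).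

    Now (1, 0) (i, 0) = (1 + i, -2) belongs to Z[i] x cZ, so 2 = c n for an
    integer n.  The center of Lambda is (0, cZ) and its commutator subgroup is
    (0, 4Z) = (0, 2 n cZ); as both are transported by conjugation, N = 2 n is
    even and c = 4 / N.  Since 4 t0 is an odd multiple of c, multiplying psi by
    a central element makes t0 equal to c / 4 or 3 c / 4; and G is generated by
    its Heisenberg part and this psi, because the powers of i exhaust its
    rotation parts (generated_heis_subset). *)

Set Implicit Arguments.
Unset Strict Implicit.
Unset Printing Implicit Defensive.

Import Order.TTheory GRing.Theory Num.Theory.
Import numFieldNormedType.Exports.

Local Open Scope card_scope.
Local Open Scope classical_set_scope.
Local Open Scope ring_scope.
Local Open Scope complex_scope.

(** * Subgroups as sets, and their conjugates *)

Section Subgroups.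
Variable G : groupType.
Implicit Types (A B : set G) (K : groupClosed G).

(** The sets met below, such as conjugates and preimages, come without a
    decidable membership; this is the propositional form of [groupClosed]. *)
Definition subgroup_set A : Prop :=
  [/\ A 1%g, forall x y, A x -> A y -> A (x * y)%g
    & forall x, A x -> A x^-1%g].

(** Classical membership turns a subgroup given as a set into one over which
    [generated] quantifies. *)
Lemma subgroup_set_groupClosed A :
  subgroup_set A -> exists K, [set` K] = A.
Proof.
case=> A1 AM AV; pose P : {pred G} := fun x => `[<A x>].
have P1 : 1%g \in P by apply/asboolP.
have PM : mulg_closed P by move=> x y /asboolP Ax /asboolP Ay; exact/asboolP/AM.
have PV : invg_closed P by move=> x /asboolP Ax; exact/asboolP/AV.
pose m1 := isMul1Closed.Build G P P1; pose mM := isMulClosed.Build G P PM.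
pose mV := isInvClosed.Build G P PV.
exists (HB.pack_for (groupClosed G) P m1 mM mV).
by apply/seteqP; split=> x /= /asboolP.
Qed.

Lemma subset_generated A : A `<=` generated A.
Proof. by move=> x Ax K; apply. Qed.

Lemma generated_subgroup A : subgroup_set (generated A).
Proof.
split=> [K _|x y gx gy K AK|x gx K AK]; rewrite ?gpred1//.
  by rewrite gpredM// ?gx// gy.
by rewrite gpredV gx.
Qed.

Lemma generated_min A B : subgroup_set B -> A `<=` B -> generated A `<=` B.
Proof. by move=> /subgroup_set_groupClosed[K <-] AK x; exact. Qed.

Lemma subgroup_setX A x n : subgroup_set A -> A x -> A (x ^+ n)%g.
Proof. by case=> A1 AM _ Ax; elim: n => // n IH; rewrite expgS; exact: AM. Qed.

Lemma groupClosed_subgroup K : subgroup_set [set` K].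
Proof.
by split=> [|x y|x] /=; rewrite ?gpred1 ?gpredV//; exact: gpredM.
Qed.

End Subgroups.

Section Conjugation.
Variable G : groupType.
Implicit Types (A B : set G) (x : G).

Definition conj_set A x : set G := [set (a ^ x)%g | a in A].

Lemma conj_setM A x y : conj_set (conj_set A x) y = conj_set A (x * y)%g.
Proof.
rewrite /conj_set image_comp; congr image; apply/funext => a.
by rewrite /= conjgM.
Qed.

Lemma conj_setE A x : conj_set A x = [set y | A (y ^ x^-1)%g].
Proof.
apply/seteqP; split=> [_ [a Aa <-]|y Ay] /=; first by rewrite conjgK.
by exists (y ^ x^-1)%g => //; rewrite conjgKV.
Qed.

Lemma conj_subgroup A x : subgroup_set A -> subgroup_set (conj_set A x).
Proof.
case=> A1 AM AV; rewrite conj_setE; split=> [|y z|y] /=.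
- by rewrite conj1g.
- by rewrite conjMg; exact: AM.
- by rewrite conjVg; exact: AV.
Qed.

Lemma conj_torsion_free A x : torsion_free A -> torsion_free (conj_set A x).
Proof.
move=> tfA _ n [a Aa <-] n0; rewrite -conjXg => /eqP; rewrite conjg_eq1.
by move=> /eqP /(tfA _ _ Aa n0) ->; rewrite conj1g.
Qed.

Lemma conj_generated A x : conj_set (generated A) x = generated (conj_set A x).
Proof.
apply/seteqP; split; last first.
  apply: generated_min; first exact/conj_subgroup/generated_subgroup.
  by apply: image_subset; exact: subset_generated.
move=> _ [a gAa <-].
suff gA : generated A `<=` [set y | generated (conj_set A x) (y ^ x)%g].
  exact: gA.
apply: generated_min => [|y Ay]; last by apply: subset_generated; exists y.
have [g1 gM gV] := generated_subgroup (conj_set A x).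
split=> [|y z|y] /=; rewrite ?conj1g ?conjMg ?conjVg//; first exact: gM.
exact: gV.
Qed.

Lemma conj_center A x : conj_set (center_of A) x = center_of (conj_set A x).
Proof.
apply/seteqP; split=> [_ [a [Aa ca] <-]|y].
  split=> [|_ [b Ab <-]]; first by exists a.
  by rewrite /commute -!conjMg (ca b Ab).
move=> [[a Aa <-] ca]; exists a => //; split=> // b Ab.
have /ca : conj_set A x (b ^ x)%g by exists b.
by rewrite /commute -!conjMg; exact: conjg_inj.
Qed.

Lemma conj_commutator A x :
  conj_set (commutator_subgroup A) x = commutator_subgroup (conj_set A x).
Proof.
rewrite /commutator_subgroup conj_generated; congr generated.
apply/seteqP; split=> [_ [u [a [b [Aa Ab ->]]] <-]|u].
  exists (a ^ x)%g, (b ^ x)%g.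
  by split; rewrite ?conjRg//; [exists a|exists b].
move=> [_ [_ [[a Aa <-] [b Ab <-] ->]]].
by exists [~ a, b]%g; [exists a, b|rewrite conjRg].
Qed.

Lemma conj_left_cosets A B x :
  left_cosets (conj_set A x) (conj_set B x) = conj_set^~ x @` left_cosets A B.
Proof.
rewrite /left_cosets /conj_set !image_comp; congr image; apply/funext => a /=.
by rewrite !image_comp; congr image; apply/funext => b /=; rewrite conjMg.
Qed.

Lemma conj_set_inj x : injective (conj_set^~ x).
Proof.
move=> A B AB; rewrite -[A](image_id) -[B](image_id).
have /(congr1 (conj_set^~ x^-1%g)) := AB; rewrite !conj_setM mulgV /conj_set.
by under eq_fun do rewrite conjg1.
Qed.

(** Conjugation maps cosets to cosets bijectively, so the index of a subgroup
    can be counted in any conjugate. *)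
Lemma card_left_cosets_conj A B x n :
  left_cosets (conj_set A x) (conj_set B x) #= `I_n ->
  quotient_card A B = n.
Proof.
rewrite conj_left_cosets => cI; apply: card_fset_set; apply: card_eq_trans cI.
by rewrite card_eq_sym; apply: inj_card_eq => ? ? _ _; exact: conj_set_inj.
Qed.

End Conjugation.

(** * Discrete subgroups of the line and of the plane *)

Section DiscreteSubgroups.
Variable R : realType.

(** A set bounded away from 0 need not attain its infimum, but it has an element
    below twice the infimum, and the factor 2 is all that the two division
    arguments below lose. *)
Lemma almost_minimum (S : set R) (e : R) :
  0 < e -> (forall s, S s -> e <= s) -> S !=set0 ->
  exists2 s, S s & forall s', S s' -> s < 2 * s'.
Proof.
move=> e0 Se S0; have hS : has_inf S by split=> //; exists e => s /Se.
have eS : e <= inf S by apply: lb_le_inf => // s /Se.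
have [s Ss sS] := inf_adherent (lt_le_trans e0 eS) hS.
exists s => // s' Ss'; apply: lt_le_trans sS _.
have : inf S <= s' by apply: ge_inf => //; case: hS.
lra.
Qed.

Lemma nearest_int (u : R) : exists q : int, `|u - q%:~R| <= 2^-1.
Proof.
exists (Num.floor (u + 2^-1)); have := floor_itv (u + 2^-1).
rewrite intrD ler_norml; move: (_%:~R) => q /=; lra.
Qed.

Definition zmod_set (V : zmodType) (A : set V) : Prop :=
  A 0 /\ forall x y, A x -> A y -> A (x - y).

Lemma zmod_setMz (V : zmodType) (A : set V) x (m : int) :
  zmod_set A -> A x -> A (x *~ m).
Proof.
move=> [A0 AB] Ax.
have AN y : A y -> A (- y) by move=> Ay; rewrite -sub0r; exact: AB.
have An n : A (x *+ n).
  elim: n => // n IH; rewrite mulrSr -[x in _ + x]opprK.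
  by apply: AB => //; exact: AN.
by case: m => n; [exact: An|rewrite NegzE mulrNz; apply/AN/An].
Qed.

(** Divide by an element c of almost minimal absolute value: the remainder has
    absolute value at most |c| / 2, hence is 0. *)
Lemma discrete_subgroup_real (A : set R) (e : R) :
  zmod_set A -> 0 < e -> (forall x, A x -> `|x| < e -> x = 0) ->
  (exists2 x, A x & x != 0) ->
  exists2 c, 0 < c & A = [set x | exists m : int, x = c * m%:~R].
Proof.
move=> zA e0 gap [x1 Ax1 x10].
pose S := [set s | exists x, [/\ A x, x != 0 & s = `|x|]].
have [_ [c [Ac c0 ->]] cmin] : exists2 s, S s & forall s', S s' -> s < 2 * s'.
  apply: (almost_minimum e0) => [_ [x [Ax x0 ->]]|]; last by exists `|x1|, x1.
  by rewrite leNgt; apply: contra_neqN x0 => /gap ->.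
exists `|c|; first by rewrite normr_gt0.
have Anc : A `|c|.
  case: (lerP 0 c) => [/ger0_norm ->|/ltr0_norm ->] //.
  by rewrite -sub0r; apply: zA.2 => //; exact: zA.1.
apply/seteqP; split=> [x Ax|_ [m ->]]; last first.
  by rewrite mulrC mulrzl; exact: zmod_setMz.
have [m hm] := nearest_int (x / `|c|); exists m; apply/eqP; rewrite -subr_eq0.
have c0' : `|c| != 0 by rewrite normr_eq0.
apply/contraT => d0; have Ad : A (x - `|c| * m%:~R).
  by apply: zA.2 => //; rewrite mulrC mulrzl; exact: zmod_setMz.
have := cmin `|x - `|c| * m%:~R| (ex_intro _ _ (And3 Ad d0 erefl)).
have -> : x - `|c| * m%:~R = `|c| * (x / `|c| - m%:~R) by field.
rewrite normrM normr_id; have : 0 < `|c| by rewrite normr_gt0.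
by move: hm; move: (`|x / `|c| - m%:~R|) (`|c|) => u v; nra.
Qed.

Lemma complex_ext (w z : R[i]) :
  complex.Re w = complex.Re z -> complex.Im w = complex.Im z -> w = z.
Proof. by case: w z => [a b] [c d] /= -> ->. Qed.

Definition normsq (w : R[i]) : R := complex.Re w ^+ 2 + complex.Im w ^+ 2.

Lemma normsqM w z : normsq (w * z) = normsq w * normsq z.
Proof. by case: w z => [a b] [c d]; rewrite /normsq /=; ring. Qed.

Lemma normsq_eq0 w : (normsq w == 0) = (w == 0).
Proof.
by case: w => a b; rewrite /normsq paddr_eq0 ?sqr_ge0// !sqrf_eq0 eq_complex.
Qed.

Lemma normsq_gt0 w : w != 0 -> 0 < normsq w.
Proof. by rewrite lt_def normsq_eq0 /normsq addr_ge0 ?sqr_ge0// => ->. Qed.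

Definition gauss (a b : int) : R[i] := a%:~R +i* b%:~R.

(** Stability under i makes L a module over the Gaussian integers.  Rounding
    both coordinates of w / al leaves a remainder of squared norm at most half
    that of al, which is less than the least squared norm, hence 0. *)
Lemma discrete_subgroup_gaussian (L : set R[i]) (e : R) :
  zmod_set L -> (forall w, L w -> L ('i * w)) -> 0 < e ->
  (forall w, L w -> normsq w < e -> w = 0) -> (exists2 w, L w & w != 0) ->
  exists2 al, al != 0 & L = [set w | exists a b, w = al * gauss a b].
Proof.
move=> zL iL e0 gap [w1 Lw1 w10].
pose S := [set s | exists w, [/\ L w, w != 0 & s = normsq w]].
have [_ [al [Lal al0 ->]] almin] :
    exists2 s, S s & forall s', S s' -> s < 2 * s'.
  apply: (almost_minimum e0) => [_ [w [Lw w0 ->]]|]; last first.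
    by exists (normsq w1), w1.
  by rewrite leNgt; apply: contra_neqN w0 => /gap ->.
exists al => //.
have Lgauss a b : L (al * gauss a b).
  have -> : al * gauss a b = al *~ a - ('i * al) *~ (- b).
    rewrite mulrNz opprK -[al *~ a]mulrzl -['i * al *~ b]mulrzl.
    have intC (m : int) : m%:~R = m%:~R +i* 0 :> R[i].
      by rewrite -(rmorph_int (real_complex R)).
    rewrite !intC.
    by case: al {Lal al0 almin} => x y; apply: complex_ext => /=; ring.
  by apply: zL.2; apply: zmod_setMz => //; exact: iL.
apply/seteqP; split=> [w Lw|_ [a [b ->]]]; last exact: Lgauss.
have [a ha] := nearest_int (complex.Re (w / al)).
have [b hb] := nearest_int (complex.Im (w / al)).
exists a, b; apply/eqP; rewrite -subr_eq0; apply/contraT => d0.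
have := almin _ (ex_intro _ _ (And3 (zL.2 _ _ Lw (Lgauss a b)) d0 erefl)).
have -> : w - al * gauss a b = al * (w / al - gauss a b) by field.
rewrite normsqM; have := normsq_gt0 al0.
have : normsq (w / al - gauss a b) <= 2^-1.
  case: (w / al) ha hb => x y /=; rewrite /normsq /=.
  by rewrite !ler_norml => /andP[? ?] /andP[? ?]; nra.
by move: (normsq al) (normsq (_ - _)) => u v; nra.
Qed.

End DiscreteSubgroups.

(** * Heisenberg translations and screw motions in coordinates *)

Section Coordinates.
Variable R : realType.
Implicit Types (w z : R[i]) (s t c : R) (x y : heisC R) (G : set (heisC R)).

Definition transl w t : heisC R := heis_incl (Heis w t).
Definition screw t : heisC R := HeisC (Heis 0 t) (cstar_i R).

Lemma heisC_eq x y :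
  hz (pr1 x) = hz (pr1 y) -> ht (pr1 x) = ht (pr1 y) ->
  val (pr2 x) = val (pr2 y) -> x = y.
Proof.
by case: x y => [[w t] l] [[z s] k] /= -> -> lk; congr HeisC; exact: val_inj.
Qed.

Lemma translM w z s t :
  (transl w s * transl z t)%g =
  transl (w + z) (s + t + 2 * complex.Im (w * z^*)).
Proof.
by apply: heisC_eq; rewrite /= ?expr0n ?expr1n ?addr0 ?sqrtr1 ?expr1n ?mul1r.
Qed.

Lemma translM_central w s t : (transl w s * transl 0 t)%g = transl w (s + t).
Proof. by rewrite translM addr0; congr transl; case: w => a b /=; ring. Qed.

Lemma translV w t : (transl w t)^-1%g = transl (- w) (- t).
Proof.
apply: (mulIg (transl w t)); rewrite mulVg translM addNr addNr.
congr (heis_incl (Heis _ _)); case: w => a b /=; ring.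
Qed.

Lemma transl_inj w z s t : transl w s = transl z t -> w = z /\ s = t.
Proof. by case. Qed.

Lemma transl_screw w s t :
  (transl w s * screw t)%g = HeisC (Heis w (s + t)) (cstar_i R).
Proof.
apply: heisC_eq; rewrite /= ?mul1r ?addr0//.
by rewrite expr0n expr1n addr0 sqrtr1 expr1n; case: w => a b /=; ring.
Qed.

Lemma transl_conj_screw w s t :
  (transl w s ^ (screw t)^-1)%g = transl ('i * w) s.
Proof.
rewrite conjgE invgK; apply: (mulIg (screw t)).
rewrite mulgA mulgVK transl_screw.
apply: heisC_eq; rewrite /= ?add0r ?mulr1//.
by rewrite mul0r /= mulr0 addr0 expr0n expr1n add0r sqrtr1 expr1n mul1r addrC.
Qed.

Lemma screw_sqr t :
  (screw t ^+ 2)%g = HeisC (Heis 0 (2 * t)) (cstar_i R * cstar_i R)%g.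
Proof.
rewrite expg2; apply: heisC_eq => /=; first by rewrite mulr0 addr0.
  by rewrite mul0r /= expr0n expr1n add0r sqrtr1 expr1n; ring.
by [].
Qed.

(** The rotation part of the square of a screw motion is -1, so the planar parts
    cancel when an element with that rotation part is squared. *)
Lemma transl_screw_sqr w s t :
  ((transl w s * screw t ^+ 2) ^+ 2)%g = transl 0 (2 * s + 4 * t).
Proof.
rewrite screw_sqr expg2; apply: heisC_eq => /=.
- by case: w => a b; apply: complex_ext => /=; ring.
- case: w => a b /=; rewrite !sqr_sqrtr ?addr_ge0 ?sqr_ge0//; ring.
- by apply: complex_ext => /=; ring.
Qed.

Lemma screw_pow4 t : (screw t ^+ 4)%g = transl 0 (4 * t).
Proof.
rewrite (expgnA _ 2 2) -[X in (X ^+ 2)%g]mul1g.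
by rewrite (_ : 1%g = transl 0 0)// transl_screw_sqr mulr0 add0r.
Qed.

(** The same as [heis_part], for a group given as a set. *)
Definition heis_subset G : set (heisC R) := G `&` range (@heis_incl R).

Lemma range_heis_incl x : range (@heis_incl R) x <-> pr2 x = 1%g.
Proof.
split=> [[g _ <-]//|]; case: x => g l /= ->; by exists g.
Qed.

Lemma pr2X x n : pr2 (x ^+ n)%g = (pr2 x ^+ n)%g.
Proof. by elim: n => // n IH; rewrite !expgS -IH. Qed.

Lemma cstar_mulC (l k : cstar R) : (l * k = k * l)%g.
Proof. by apply: val_inj; rewrite /= mulrC. Qed.

Lemma pr2J x y : pr2 (x ^ y)%g = pr2 x.
Proof. by rewrite conjgE /= cstar_mulC -mulgA mulgV mulg1. Qed.

Lemma conj_heis_subset G x :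
  conj_set (heis_subset G) x = heis_subset (conj_set G x).
Proof.
apply/seteqP; split=> [_ [a [Ga /range_heis_incl a1] <-]|_ [[a Ga <-]]].
  by split; [exists a|apply/range_heis_incl; rewrite pr2J].
move=> /range_heis_incl; rewrite pr2J => a1; exists a => //; split=> //.
exact/range_heis_incl.
Qed.

Lemma cstar_i4 : (cstar_i R ^+ 4 = 1)%g.
Proof. by apply: val_inj; apply: complex_ext => /=; ring. Qed.

Lemma generated_cstar_i :
  generated [set cstar_i R] `<=` [set (cstar_i R ^+ n)%g | n in setT].
Proof.
apply: generated_min => [|_ ->]; last by exists 1%N.
split=> [|_ _ [m _ <-] [n _ <-]|_ [n _ <-]]; first by exists 0%N.
  by exists (m + n)%N; rewrite // expgnDr.
exists (3 * n)%N => //; apply: (mulIg (cstar_i R ^+ n)%g).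
by rewrite mulVg -expgnDr -[X in (_ + X)%N]mul1n -mulnDl expgnA cstar_i4 expg1n.
Qed.

(** The rotation part of y in G is a power of i, so y times the inverse power of
    x has trivial rotation part. *)
Lemma generated_heis_subset G x :
  subgroup_set G -> @pr2 R @` G `<=` generated [set cstar_i R] ->
  G x -> pr2 x = cstar_i R -> G = generated (heis_subset G `|` [set x]).
Proof.
move=> sG Gi Gx xi; have [G1 GM GV] := sG; apply/seteqP; split; last first.
  by apply: generated_min => // y [[]|->].
move=> y Gy; have [|n _ yn] := @generated_cstar_i (pr2 y).
  by apply: Gi; exists y.
have gS := generated_subgroup (heis_subset G `|` [set x]); have [_ gM _] := gS.
rewrite -[y](mulgVK (x ^+ n)%g); apply: gM; last first.
  by apply: (subgroup_setX _ gS); apply: subset_generated; right.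
apply: subset_generated; left; split.
  by apply: GM => //; apply: GV; exact: subgroup_setX.
by apply/range_heis_incl; rewrite /= pr2X xi yn mulgV.
Qed.

End Coordinates.

(** * The Heisenberg part of a straightened group *)

Lemma int_parity (k : int) : exists j : int, k = 2 * j \/ k = 2 * j + 1.
Proof. by exists (k %/ 2)%Z; lia. Qed.

Section Structure.
Variables (R : realType) (G : set (heisC R)) (t0 : R).
Hypotheses (sG : subgroup_set G) (tfG : torsion_free G) (Gscrew : G (screw t0)).

(** An element of rotation part -1 is never 1, so torsion-freeness forbids its
    square to be 1. *)
Lemma screw_obstruction w s : G (transl w s) -> 2 * s + 4 * t0 != 0.
Proof.
move=> Gws; apply/eqP => st0; have [_ GM _] := sG.
have Gx : G (transl w s * screw t0 ^+ 2)%g.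
  by apply: GM => //; exact: subgroup_setX.
have := tfG Gx (ltn0Sn 1); rewrite transl_screw_sqr st0 => /(_ erefl).
move=> /(congr1 (fun x => complex.Re (val (pr2 x)))) /=.
lra.
Qed.

Lemma heis_subsetE w t : heis_subset G (transl w t) <-> G (transl w t).
Proof. by split=> [[]//|Gwt]; split=> //; exists (Heis w t). Qed.

Lemma rotate_transl w t : G (transl w t) -> G (transl ('i * w) t).
Proof.
have [_ GM GV] := sG; rewrite -(transl_conj_screw w t t0) conjgE invgK => Gw.
by apply: (GM) => //; apply: (GM) => //; exact: GV.
Qed.

(** Two conjugations by the screw motion turn (w, t) into (-w, t); the product
    of these two elements is central. *)
Lemma double_height w t : G (transl w t) -> G (transl 0 (2 * t)).
Proof.
have [_ GM GV] := sG => Gwt.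
have := GM _ _ Gwt (rotate_transl (rotate_transl Gwt)).
rewrite translM; congr (G (transl _ _)); case: w {Gwt} => a b /=; last ring.
by apply: complex_ext => /=; ring.
Qed.

Variable e : R.
Hypotheses (e0 : 0 < e).
Hypothesis gap : forall w t,
  G (transl w t) -> normsq w < e -> `|t| < e -> w = 0 /\ t = 0.

(** Both the oddness of 4 t0 / c and the integrality of t / c come from
    [screw_obstruction]: an even multiple, or a height in c / 2 + cZ, could be
    corrected by a central element so as to violate it. *)
Lemma height_lattice : exists (c : R) (j : int),
  [/\ 0 < c, 4 * t0 = c * (2 * j + 1)%:~R,
      forall m : int, G (transl 0 (c * m%:~R))
    & forall w t, G (transl w t) -> exists m : int, t = c * m%:~R].
Proof.
have [G1 GM GV] := sG.
pose Z : set R := [set t | G (transl 0 t)].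
have zZ : zmod_set Z.
  split=> [|x y Zx /GV Zy]; first exact: G1.
  by have := GM _ _ Zx Zy; rewrite translV oppr0 translM_central.
have [||c c0 ZE] := @discrete_subgroup_real _ Z e zZ e0.
- move=> x Zx xe; have [|//|//] := gap Zx.
  by rewrite /normsq /= expr0n addr0.
- exists (4 * t0); first by rewrite /Z /= -screw_pow4; exact: subgroup_setX.
  by have := @screw_obstruction 0 0 G1; rewrite mulr0 add0r.
have Gc (m : int) : G (transl 0 (c * m%:~R)).
  by have : Z (c * m%:~R) by rewrite ZE; exists m.
have [k k4] : exists k : int, 4 * t0 = c * k%:~R.
  have : Z (4 * t0) by rewrite /Z /= -screw_pow4; exact: subgroup_setX.
  by rewrite ZE.
have [j jk] : exists j : int, k = 2 * j + 1.
  have [j [kj|]] := int_parity k; last by exists j.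
  have := screw_obstruction (Gc (- j)).
  by rewrite k4 kj intrM intrN => /eqP; case; ring.
exists c, j; split=> //; first by rewrite k4 jk.
move=> w t Gwt.
have [m m2] : exists m : int, 2 * t = c * m%:~R.
  by have : Z (2 * t) by [exact: (double_height Gwt)]; rewrite ZE.
have [q [mq|mq]] := int_parity m.
  by exists q; move: m2; rewrite mq intrM; lra.
(* Here t = c (q + 1/2): the correction makes 2 s + 4 t0 equal to
   c (2 q + 1) - 2 c (q + j + 1) + c (2 j + 1) = 0. *)
have := GM _ _ Gwt (Gc (- (q + j + 1))).
rewrite translM_central => /screw_obstruction /eqP; case.
by rewrite mulrDr m2 k4 mq jk !(intrD, intrM, intrN); ring.
Qed.

Hypothesis noncentral : exists w t, G (transl w t) /\ w != 0.

(** As all heights lie in cZ and (0, cZ) belongs to G, every planar part w is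
    already that of (w, 0); hence the planar parts form a discrete group stable
    under i. *)
Lemma heis_subset_gaussian : exists (al : R[i]) (c : R) (j : int),
  [/\ al != 0, 0 < c, 4 * t0 = c * (2 * j + 1)%:~R &
   heis_subset G = [set x | exists a b m : int,
     x = transl (al * gauss R a b) (c * m%:~R)]].
Proof.
have [G1 GM GV] := sG.
have [c [j [c0 t0j Gc Lc]]] := height_lattice.
pose L : set R[i] := [set w | G (transl w 0)].
have GL w t : G (transl w t) <-> L w /\ exists m : int, t = c * m%:~R.
  split=> [Gwt|[Lw [m ->]]].
    have [m mt] := Lc _ _ Gwt; split; last by exists m.
    have := GM _ _ Gwt (Gc (- m)).
    by rewrite translM_central mt intrN mulrN subrr.
  by have := GM _ _ Lw (Gc m); rewrite translM_central add0r.
have zL : zmod_set L.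
  split=> [|x y Lx /GV]; first exact: G1.
  by rewrite translV => Ly; have := GM _ _ Lx Ly; rewrite translM => /GL[].
have [||||al al0 LE] := @discrete_subgroup_gaussian _ L e zL.
- by move=> w; exact: rotate_transl.
- by [].
- by move=> w Lw we; have [//||//] := gap Lw; rewrite normr0.
- by have [w [t [/GL[Lw _] w0]]] := noncentral; exists w.
exists al, c, j; split=> //; apply/seteqP.
split=> [x [Gx [[w t] _ xE]]|_ [a [b [m ->]]]].
  move: Gx; rewrite -xE => /GL[].
  by rewrite LE => -[a [b ->]] [m ->]; exists a, b, m.
apply: (heis_subsetE _ _).2; apply/GL; split; last by exists m.
by rewrite LE; exists a, b.
Qed.
End Structure.

(** * The standard lattice, its center and its commutators *)

Section Models.
Variable R : realType.
Implicit Types (c : R) (K : set (heis R)).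

Definition gaussian_heis c : set (heis R) :=
  [set h | exists a b m : int, h = Heis (gauss R a b) (c * m%:~R)].

(** A subgroup containing f s contains its integer powers; stated for a
    one-parameter subgroup f, these powers come directly in coordinates. *)
Lemma one_parameter_int K (f : R -> heis R) (s : R) (m : int) :
  subgroup_set K -> {morph f : u v / u + v >-> (u * v)%g} ->
  K (f s) -> K (f (s * m%:~R)).
Proof.
move=> [K1 KM KV] fM Ks.
have f0 : f 0 = 1%g by apply: (mulgI (f 0)); rewrite -fM addr0 mulg1.
have Kn (n : nat) : K (f (s * n%:R)).
  elim: n => [|n IH]; first by rewrite mulr0 f0.
  by rewrite -natr1 mulrDr mulr1 fM; exact: KM.
case: m => n; first exact: Kn.
rewrite NegzE intrN mulrN; set v := s * _.
have -> : f (- v) = (f v)^-1%g.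
  by apply: (mulIg (f v)); rewrite -fM addNr f0 mulVg.
exact/KV/Kn.
Qed.

(** The product of (1, 0)^a and (i, 0)^b is (a + b i, - 2 a b): the height is a
    multiple of c precisely because 2 is, which makes the set on the right a
    group. *)
Lemma heis_lattice_iE c (n : int) : 2 = c * n%:~R ->
  heis_lattice 'i c = gaussian_heis c.
Proof.
move=> cn; apply/seteqP; split.
- apply: generated_min => [|h].
    split.
    + by exists 0, 0, 0; congr Heis; rewrite ?mulr0//; apply: complex_ext.
    + move=> _ _ [a [b [m ->]]] [a' [b' [m' ->]]].
      exists (a + a'), (b + b'), (m + m' + n * (b * a' - a * b')).
      congr Heis; first by apply: complex_ext; rewrite /= intrD.
      have /= := congr1 ( *%R^~ (b%:~R * a'%:~R - a%:~R * b'%:~R)) cn.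
      by rewrite !(intrD, intrM, intrN); lra.
    + move=> _ [a [b [m ->]]]; exists (- a), (- b), (- m); congr Heis.
        by apply: complex_ext; rewrite /= intrN.
      by rewrite /= intrN mulrN.
  move=> [[->|->]|->].
  + by exists 1, 0, 0; congr Heis; rewrite ?mulr0//; apply: complex_ext.
  + by exists 0, 1, 0; congr Heis; rewrite ?mulr0//; apply: complex_ext.
  + by exists 0, 0, 1; congr Heis; rewrite ?mulr1//; apply: complex_ext.
- move=> _ [a [b [m ->]]].
  have gS := generated_subgroup [set Heis 1 0; Heis 'i 0; Heis 0 c].
  have [_ gM _] := gS.
  pose fx (u : R) : heis R := Heis (u +i* 0) 0.
  pose fy (u : R) : heis R := Heis (0 +i* u) 0.
  pose ft (u : R) : heis R := Heis 0 u.
  have fxM : {morph fx : u v / u + v >-> (u * v)%g}.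
    move=> u v; congr Heis; first by apply: complex_ext => /=; ring.
    by rewrite /=; ring.
  have fyM : {morph fy : u v / u + v >-> (u * v)%g}.
    move=> u v; congr Heis; first by apply: complex_ext => /=; ring.
    by rewrite /=; ring.
  have ftM : {morph ft : u v / u + v >-> (u * v)%g}.
    move=> u v; congr Heis; first by apply: complex_ext => /=; ring.
    by rewrite /=; ring.
  have gx : heis_lattice 'i c (fx (1 * a%:~R)).
    apply: (one_parameter_int _ gS) => //; apply: subset_generated; left; left.
    by congr Heis; apply: complex_ext.
  have gy : heis_lattice 'i c (fy (1 * b%:~R)).
    apply: (one_parameter_int _ gS) => //; apply: subset_generated; left; right.
    by congr Heis; apply: complex_ext.
  have gt : heis_lattice 'i c (ft (c * (m + n * a * b)%:~R)).
    by apply: (one_parameter_int _ gS) => //; apply: subset_generated; right.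
  have := gM _ _ (gM _ _ gx gy) gt.
  congr (heis_lattice _ _ _); congr Heis.
    by apply: complex_ext => /=; ring.
  have /= := congr1 ( *%R^~ (a%:~R * b%:~R)) cn.
  by rewrite !(intrD, intrM); lra.
Qed.

Lemma transl_gaussian c a b :
  (@heis_incl R @` gaussian_heis c) (transl (gauss R a b) 0).
Proof.
by exists (Heis (gauss R a b) 0) => //; exists a, b, 0; rewrite mulr0.
Qed.

(** Commuting with (1, 0) and with (i, 0) kills both coordinates of the planar
    part. *)
Lemma center_gaussian c :
  center_of (@heis_incl R @` gaussian_heis c) =
  [set transl 0 (c * m%:~R) | m in [set: int]].
Proof.
apply/seteqP; split=> [x [[_ [a [b [m ->]]] <-] com]|_ [m _ <-]]; last first.
  split.
    exists (Heis 0 (c * m%:~R)) => //; exists 0, 0, m.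
    by congr Heis; apply: complex_ext.
  move=> _ [_ [a [b [k ->]]] <-]; rewrite /commute !translM.
  by congr transl; [rewrite addrC|rewrite /=; ring].
exists m => //; congr transl.
have := com _ (transl_gaussian c 1 0); have := com _ (transl_gaussian c 0 1).
rewrite /commute !translM => /transl_inj[_ /=] + /transl_inj[_ /=] => h1 h2.
by apply: complex_ext => /=; lra.
Qed.

(** The commutator of (w, s) and (z, t) is (0, 4 Im (w conj(z))), and
    (0, 4 m) is the commutator of (i, 0) and (m, 0). *)
Lemma commutator_gaussian c :
  commutator_subgroup (@heis_incl R @` gaussian_heis c) =
  [set transl 0 (4 * m%:~R) | m in [set: int]].
Proof.
apply/seteqP; split.
  apply: generated_min; last first.
    move=> _ [_ [_ [[_ [a [b [m ->]]] <-] [_ [a' [b' [m' ->]]] <-] ->]]].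
    exists (b * a' - a * b') => //; rewrite commgEl conjgE !translV !translM.
    congr transl; first by apply: complex_ext => /=; ring.
    by rewrite /= !(intrD, intrM, intrN); ring.
  split=> [|_ _ [m _ <-] [k _ <-]|_ [m _ <-]].
  - by exists 0; rewrite // mulr0.
  - by exists (m + k); rewrite // translM_central intrD mulrDr.
  - by exists (- m); rewrite // translV oppr0 intrN mulrN.
move=> _ [m _ <-]; apply: subset_generated.
exists (transl (gauss R 0 1) 0), (transl (gauss R m 0) 0).
split; [exact: transl_gaussian|exact: transl_gaussian|].
rewrite commgEl conjgE !translV !translM.
congr transl; first by apply: complex_ext => /=; ring.
by rewrite /=; ring.
Qed.

Lemma left_cosets_gaussian c (n : nat) : 4 = c * n%:R ->
  left_cosets (center_of (@heis_incl R @` gaussian_heis c))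
    (commutator_subgroup (@heis_incl R @` gaussian_heis c)) #= `I_n.
Proof.
move=> cn; rewrite center_gaussian commutator_gaussian.
have c0 : c != 0 by apply/eqP => c0; move: cn; rewrite c0 mul0r; lra.
have n0 : (0 < n)%N.
  by rewrite lt0n; apply/eqP => n0; move: cn; rewrite n0 mulr0; lra.
(* As 4 = c n, the coset of (0, c m) only depends on m modulo n. *)
pose C (m : int) : set (heisC R) :=
  [set transl 0 (c * (m + n%:Z * k)%:~R) | k in [set: int]].
have CE m : [set (transl 0 (c * m%:~R) * b)%g
    | b in [set transl 0 (4 * k%:~R) | k in [set: int]]] = C m.
  rewrite image_comp; congr image; apply/funext => k /=.
  by rewrite translM_central intrD mulrDr intrM mulrA -cn.
have -> : left_cosets [set transl 0 (c * m%:~R) | m in [set: int]]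
    [set transl 0 (4 * m%:~R) | m in [set: int]] =
    (fun j : nat => C j) @` `I_n.
  rewrite /left_cosets image_comp; apply/seteqP.
  split=> [_ [m _ <-]|_ [j _ <-]]; last first.
    by exists j; rewrite //= CE.
  exists `|(m %% n)%Z|%N; first by rewrite /=; lia.
  rewrite /= CE; apply/seteqP; split=> _ [k _ <-].
    by exists (k - (m %/ n)%Z) => //; congr (transl 0 (c * _%:~R)); lia.
  by exists (k + (m %/ n)%Z) => //; congr (transl 0 (c * _%:~R)); lia.
apply: inj_card_eq => i j; rewrite !inE /= => i_n j_n Cij.
have : C i (transl 0 (c * (i%:Z)%:~R)) by exists 0; rewrite // mulr0 addr0.
rewrite Cij => -[k _ /transl_inj[_ /(mulfI c0)]] /eqP.
rewrite eqr_int => /eqP ik; clear -i_n j_n ik.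
have k0 : k = 0 by case: (ltgtP k 0) => // k0; nia.
by move: ik; rewrite k0; lia.
Qed.

End Models.

(** * From the topology of the action to inequalities *)

Section Topology.
Variable R : realType.

Lemma normc_ltP (w : R[i]) (e : R) :
  0 < e -> (`|w| < e%:C) = (normsq w < e ^+ 2).
Proof.
move=> e0; rewrite normc_def ltcR -ltr_sqr ?nnegrE ?sqrtr_ge0 ?(ltW e0)//.
by rewrite sqr_sqrtr ?addr_ge0 ?sqr_ge0.
Qed.

Lemma Re_continuous : continuous (@complex.Re R).
Proof.
move=> z A /nbhs_ballP[e /= e0 eA]; apply/nbhs_ballP.
exists e%:C; first by rewrite /= ltcR.
move=> w; rewrite -ball_normE /= normc_ltP// => h; apply: eA.
rewrite -ball_normE /= -ltr_sqr ?nnegrE ?(ltW e0)//.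
rewrite -normrX ger0_norm ?sqr_ge0//; apply: le_lt_trans h; rewrite /normsq.
by case: z w => [a b] [c d] /=; rewrite lerDl sqr_ge0.
Qed.

Lemma Im_continuous : continuous (@complex.Im R).
Proof.
move=> z A /nbhs_ballP[e /= e0 eA]; apply/nbhs_ballP.
exists e%:C; first by rewrite /= ltcR.
move=> w; rewrite -ball_normE /= normc_ltP// => h; apply: eA.
rewrite -ball_normE /=.
rewrite -ltr_sqr ?nnegrE ?(ltW e0)//.
rewrite -normrX ger0_norm ?sqr_ge0//; apply: le_lt_trans h; rewrite /normsq.
by case: z w => [a b] [c d] /=; rewrite lerDr sqr_ge0.
Qed.

Lemma normsq_continuous (p : R[i]) :
  continuous (fun z : R[i] => normsq (z - p)).
Proof.
move=> z; have subc : {for z, continuous (fun z : R[i] => z - p)}.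
  move=> A /nbhs_ballP[e /= e0 eA]; apply/nbhs_ballP; exists e => // w.
  rewrite -ball_normE /= => h; apply: eA; rewrite -ball_normE /=.
  by rewrite opprB addrA subrK.
have re : {for z, continuous (fun z : R[i] => complex.Re (z - p))}.
  by apply: continuous_comp; [exact: subc|exact: Re_continuous].
have im : {for z, continuous (fun z : R[i] => complex.Im (z - p))}.
  by apply: continuous_comp; [exact: subc|exact: Im_continuous].
exact: (cvgD (cvgM re re) (cvgM im im)).
Qed.

Lemma transl_continuous : continuous (fun u : R[i] * R => transl u.1 u.2).
Proof.
apply: continuous_comp_initial.
have hc : continuous (fun u : R[i] * R => Heis u.1 u.2).
  apply: continuous_comp_initial.
  rewrite (_ : _ \o _ = id); last by apply/funext => -[].
  by move=> u; exact: cvg_id.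
move=> u; exact: (cvg_pair (hc u) (cvg_cst (1%g : cstar R))).
Qed.

(** Discreteness at the identity, read in the coordinates of the Heisenberg
    part. *)
Lemma discrete_gap (Gamma : groupClosed (heisC R)) :
  discrete_subset [set` Gamma] ->
  exists2 e, 0 < e & forall w t, transl w t \in Gamma ->
    normsq w < e -> `|t| < e -> w = 0 /\ t = 0.
Proof.
move=> /(_ 1%g) /=; rewrite gpred1 => /(_ isT)[_ [V V1 VG]].
have /(transl_continuous (x := (0, 0))) : nbhs (transl 0 0 : heisC R) V by [].
move=> [[A B] [/= /nbhs_ballP[a /= a0 aA] /nbhs_ballP[b /= b0 bB]] ABV].
have aE : a = (complex.Re a)%:C.
  by move: a0; case: (a) => x y; rewrite ltcE /= => /andP[/eqP -> _].
have a0' : 0 < complex.Re a by rewrite -ltcR -aE.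
exists (Num.min (complex.Re a ^+ 2) b); first by rewrite lt_min exprn_gt0.
move=> w t Gwt; rewrite !lt_min => /andP[wa _] /andP[_ tb].
suff : ([set 1%g] : set (heisC R)) (transl w t) by move=> /transl_inj.
rewrite -VG; split=> //; apply: (ABV (w, t)); split=> /=.
  by apply: aA; rewrite -ball_normE /= sub0r normrN aE normc_ltP.
by apply: bB; rewrite -ball_normE /= sub0r normrN.
Qed.

(** The squared distance to p in the plane is continuous and unbounded on the
    Heisenberg group; if Gamma preserved it, it would descend to a compact
    space. *)
Lemma cocompact_unbounded (Gamma : groupClosed (heisC R)) (p : R[i]) :
  compact [set: orbit_space Gamma] ->
  exists x h, x \in Gamma /\
    normsq (hz (heisC_act x h) - p) != normsq (hz h - p).
Proof.
move=> cpt; apply: contrapT => inv.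
pose f (h : heis R) : R := normsq (hz h - p).
have fc : continuous f.
  move=> h; apply: (@continuous_comp _ _ _ (@hz R) (fun z => normsq (z - p))).
    have hc : continuous (@fst R[i] R \o @heis_pair R).
      move=> g; apply: continuous_comp; first exact: initial_continuous.
      exact: cvg_fst.
    exact: hc.
  exact: normsq_continuous.
have fi : {homo f : a b /
    (\pi_(orbit_space Gamma) a == \pi_(orbit_space Gamma) b)%qT >-> a == b}.
  move=> a b /eqP /eqmodP /= /asboolP[x xG ->]; apply/eqP.
  apply: contrapT => fab.
  by apply: inv; exists x, b; split=> //; exact/eqP.
have gc := repr_comp_continuous fc fi.
have := continuous_compact (continuous_subspaceT gc) cpt.
move=> /compact_bounded[M [_ Mb]].
pose h := Heis (p + (`|M| + 2)%:C) 0.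
have /Mb/(_ (f h)) : M < `|M| + 1.
  by rewrite (le_lt_trans (ler_norm M))// ltrDl.
have fh : f (repr (\pi_(orbit_space Gamma) h)%qT) = f h.
  by apply/eqP/fi; rewrite reprK.
have hf : [set (f \o repr) q | q in [set: orbit_space Gamma]] (f h).
  by exists (\pi_(orbit_space Gamma) h)%qT.
move=> /(_ hf); rewrite /f /h /normsq /= addrAC subrr add0r.
rewrite /= expr0n addr0 ger0_norm ?sqr_ge0//.
by have := normr_ge0 M; move: `|M| => u; nra.
Qed.

End Topology.

(** * Straightening a group with rotation part generated by i *)

Section Main.
Variable R : realType.
Implicit Types (w z p : R[i]) (s t c : R) (x y : heisC R) (G : set (heisC R)).

Lemma conjg_intertwine (H : groupType) (a b x : H) :
  (a * x = x * b)%g -> (a ^ x)%g = b.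
Proof. by move=> ax; rewrite conjgE ax mulKg. Qed.

Lemma transl_conj_transl w t p :
  (transl w t ^ (transl p 0)^-1)%g = transl w (t + 4 * complex.Im (p * w^*)).
Proof.
apply: conjg_intertwine; rewrite translV oppr0 !translM.
congr transl; first by rewrite addrC.
by case: p w => a b [d e] /=; ring.
Qed.

(** Conjugation by (p, 0) shears the heights by 4 Im (p conj(w)), at most
    4 |p| |w| in absolute value; so the gap persists once w is small
    compared to e / |p|. *)
Lemma gap_conj_transl G p (e : R) : 0 < e ->
  (forall w t, G (transl w t) -> normsq w < e -> `|t| < e -> w = 0 /\ t = 0) ->
  exists2 e', 0 < e' & forall w t, conj_set G (transl p 0) (transl w t) ->
    normsq w < e' -> `|t| < e' -> w = 0 /\ t = 0.
Proof.
move=> e0 gap; have np : 0 <= normsq p by rewrite addr_ge0 ?sqr_ge0.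
pose d := e ^+ 2 / (64 * (normsq p + 1)).
have d0 : 0 < d by rewrite divr_gt0 ?exprn_gt0 ?mulr_gt0 ?ltr_wpDl.
exists (Num.min (e / 2) d); first by rewrite lt_min d0 divr_gt0.
move=> w t; rewrite conj_setE /= transl_conj_transl !lt_min.
move=> Gw /andP[we wd] /andP[te _].
set u := 4 * _ in Gw.
have u2 : u ^+ 2 < (e / 2) ^+ 2.
  have hu : u ^+ 2 <= 16 * (normsq p * normsq w).
    rewrite /u; case: (p) (w) => a b [f g]; rewrite /normsq /=.
    by have := sqr_ge0 (a * f + b * g); lra.
  move: wd; rewrite /d ltr_pdivlMr ?mulr_gt0 ?ltr_wpDl// => wd.
  have nw : 0 <= normsq w by rewrite addr_ge0 ?sqr_ge0.
  by nra.
have ue : `|u| < e / 2.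
  rewrite -ltr_sqr ?nnegrE ?divr_ge0 ?(ltW e0)//.
  by rewrite -normrX ger0_norm ?sqr_ge0.
have [||w0 tu] := gap _ _ Gw; first by lra.
  by apply: le_lt_trans (ler_normD _ _) _; lra.
have u0 : u = 0 by rewrite /u w0; case: (p) => a b /=; ring.
by split=> //; move: tu; rewrite u0 addr0.
Qed.

(** The fixed point p of z |-> z1 + i z is z1 / (1 - i). *)
Lemma conj_to_screw x : pr2 x = cstar_i R ->
  exists p t, (x ^ (transl p 0))%g = screw t.
Proof.
move=> xi; pose p := hz (pr1 x) / (1 - 'i).
exists p, (ht (pr1 (x ^ transl p 0)%g)).
apply: heisC_eq => //; last by rewrite pr2J xi.
have i1 : 1 - 'i != 0 :> R[i] by rewrite eq_complex /= subr0 oner_eq0.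
have pE : hz (pr1 x) = p * (1 - 'i) by rewrite divfK.
rewrite conjgE translV /= xi /= !mul1r pE.
by rewrite mulrBr mulr1 [p * 'i]mulrC subrK addNr.
Qed.

(** If the Heisenberg part were central, G would be generated by vertical
    translations and a screw motion about the origin, all of which preserve
    |z|. *)
Lemma noncentral_of_unbounded G t0 :
  subgroup_set G -> @pr2 R @` G `<=` generated [set cstar_i R] ->
  G (screw t0) ->
  (exists x h, G x /\ normsq (hz (heisC_act x h)) != normsq (hz h)) ->
  exists w t, G (transl w t) /\ w != 0.
Proof.
move=> sG Gi Gscrew [x [h [Gx]]]; apply: contraPP => central.
apply/negP; rewrite negbK.
pose K : set (heisC R) :=
  [set y | forall h, normsq (hz (heisC_act y h)) = normsq (hz h)].
have sK : subgroup_set K.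
  split=> [g|y z Ky Kz g|y Ky g]; first by rewrite heisC_act1.
    by rewrite heisC_actM Ky Kz.
  by rewrite -Ky -heisC_actM mulgV heisC_act1.
suff GK : G `<=` K by rewrite (GK _ Gx h).
rewrite (generated_heis_subset sG Gi Gscrew)//.
apply: generated_min => // y [|->].
  move=> [Gy [[w t] _ yE]] g; rewrite -yE /= mul1r.
  have [->|w0] := eqVneq w 0; first by rewrite add0r.
  by exfalso; apply: central; exists w, t; rewrite /transl yE.
move=> [[a b] s]; rewrite /heisC_act /normsq /=; ring.
Qed.

Definition dilation (al : R[i]) (al0 : al != 0) : heisC R :=
  HeisC 1%g (Cstar al0).

Lemma transl_conj_dilation (al : R[i]) (al0 : al != 0) w t :
  (transl (al * w)%R (normsq al * t)%R ^ dilation al0)%g = transl w t.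
Proof.
apply: conjg_intertwine; apply: heisC_eq => /=.
- by rewrite mulr0 addr0 add0r.
- rewrite normc_sqr; case: (al) w {al0} => a b [d e]; rewrite /normsq /=.
  by ring.
- by rewrite mul1r mulr1.
Qed.

Lemma screw_conj_dilation (al : R[i]) (al0 : al != 0) t :
  (screw (normsq al * t)%R ^ dilation al0)%g = screw t.
Proof.
apply: conjg_intertwine; apply: heisC_eq => /=.
- by rewrite !mulr0 !addr0.
- by rewrite normc_sqr; case: (al) {al0} => a b; rewrite /normsq /=; ring.
- by rewrite mulrC.
Qed.

Lemma conj_pr2 G x : @pr2 R @` conj_set G x = @pr2 R @` G.
Proof.
by rewrite /conj_set image_comp; congr image; apply/funext => a; exact: pr2J.
Qed.

(** The translation to the fixed point of an element of rotation part i,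
    followed by the dilation by a generator of the planar lattice. *)
Lemma normal_form (Gamma : groupClosed (heisC R)) :
  heisenberg_bieberbach Gamma ->
  @pr2 R @` [set` Gamma] = generated [set cstar_i R] ->
  exists x c (j : int) t, let G := conj_set [set` Gamma] x in
  [/\ 0 < c, 4 * t = c * (2 * j + 1)%:~R, G (screw t) &
    heis_subset G = @heis_incl R @` gaussian_heis c].
Proof.
move=> [_ dG tfG cG] GE.
have [x Gx xi] : (@pr2 R @` [set` Gamma]) (cstar_i R).
  by rewrite GE; exact: subset_generated.
have [p [t0 xp]] := conj_to_screw xi.
pose G := conj_set [set` Gamma] (transl p 0).
have sG : subgroup_set G by apply/conj_subgroup/groupClosed_subgroup.
have Gscrew : G (screw t0) by exists x.
have Gi : @pr2 R @` G `<=` generated [set cstar_i R] by rewrite conj_pr2 GE.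
have [e0 e0p gap0] := discrete_gap dG.
have [e ep gap] := @gap_conj_transl [set` Gamma] p e0 e0p gap0.
have noncentral : exists w t, G (transl w t) /\ w != 0.
  apply: (noncentral_of_unbounded sG Gi Gscrew).
  have [y [h [Gy yh]]] := cocompact_unbounded p cG.
  exists (y ^ transl p 0)%g, (heisC_act (transl p 0)^-1%g h).
  split; first by exists y.
  rewrite -heisC_actM conjgE -mulgA -mulgA mulgV mulg1 heisC_actM.
  by rewrite translV /= !mul1r ![- p + _]addrC.
have tfG' : torsion_free G by exact: conj_torsion_free.
have [al [c [j [al0 c0 tj GL]]]] :=
  heis_subset_gaussian sG tfG' Gscrew ep gap noncentral.
have n0 := normsq_gt0 al0; have n0' : normsq al != 0 by rewrite gt_eqF.
exists (transl p 0 * dilation al0)%g, (c / normsq al), j, (t0 / normsq al).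
rewrite -conj_setM -/G; split.
- exact: divr_gt0.
- by rewrite mulrA tj mulrAC.
- exists (screw t0) => //.
  by rewrite -[RHS](screw_conj_dilation al0) [(normsq al * _)%R]mulrC divfK.
rewrite -conj_heis_subset GL.
have translE a b (m : int) :
    (transl (al * gauss R a b)%R (c * m%:~R)%R ^ dilation al0)%g =
    transl (gauss R a b) (c / normsq al * m%:~R).
  rewrite -[RHS](transl_conj_dilation al0); congr (transl _ _ ^ _)%g.
  by field.
apply/seteqP; split=> [_ [_ [a [b [m ->]]] <-]|_ [_ [a [b [m ->]]] <-]].
  rewrite translE; exists (Heis (gauss R a b) (c / normsq al * m%:~R)) => //.
  by exists a, b, m.
rewrite -[heis_incl _]translE.
by exists (transl (al * gauss R a b) (c * m%:~R)) => //; exists a, b, m.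
Qed.

End Main.

Theorem proposition6p1 (R : realType) (Gamma : groupClosed (heisC R)) :
  heisenberg_bieberbach Gamma ->
  @pr2 R @` [set` Gamma] = generated [set cstar_i R] ->
  let Lambda := heis_part Gamma in
  let N := quotient_card (center_of Lambda) (commutator_subgroup Lambda) in
  let c : R := 4 / N%:R in
  ~~ odd N /\
  (conjugate [set` Gamma] (bieberbach_model c) \/
   conjugate [set` Gamma] (bieberbach_model' c)).
Proof.
move=> bG GE Lambda N.
have [x [c [j [t [c0 tj Gscrew GL]]]]] := normal_form bG GE.
set G := conj_set _ x in Gscrew GL.
have sG : subgroup_set G by apply/conj_subgroup/groupClosed_subgroup.
have Gi : @pr2 R @` G `<=` generated [set cstar_i R] by rewrite conj_pr2 GE.
have [_ GM _] := sG.
have Gcentral (m : int) : G (transl 0 (c * m%:~R)).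
  have [] // : heis_subset G (transl 0 (c * m%:~R)).
  rewrite GL; exists (Heis 0 (c * m%:~R)) => //; exists 0, 0, m.
  by congr Heis; apply: complex_ext.
(* (1, 0) (i, 0) = (1 + i, -2), and all heights are in cZ. *)
have [n n2] : exists n : nat, 2 = c * n%:R.
  have Gg a b : G (transl (gauss R a b) 0).
    have [] // : heis_subset G (transl (gauss R a b) 0).
    by rewrite GL; exact: transl_gaussian.
  have : heis_subset G (transl (gauss R 1 0) 0 * transl (gauss R 0 1) 0)%g.
    by split; [exact: GM|rewrite translM; eexists].
  rewrite GL translM => -[_ [a [b [m ->]]]] /transl_inj[_ /=] cm.
  exists `|m|%N.
  have m0 : m%:~R <= 0 :> R.
    by rewrite -(pmulr_rle0 _ c0) cm; lra.
  rewrite natr_absz ler0_norm; last by rewrite -(lerz0 R).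
  by rewrite intrN mulrN cm; lra.
have NE : N = (2 * n)%N.
  apply: (@card_left_cosets_conj _ _ _ x).
  rewrite conj_center conj_commutator.
  rewrite -[Lambda]/(heis_subset [set` Gamma]) conj_heis_subset -/G GL.
  apply: left_cosets_gaussian.
  by rewrite natrM; lra.
have n0 : n%:R != 0 :> R by apply/eqP => n0; move: n2; rewrite n0 mulr0; lra.
have -> : 4 / N%:R = c.
  by rewrite NE natrM; apply: (mulIf n0); rewrite -n2; field.
have latE : heis_lattice 'i%C c = gaussian_heis c.
  exact: (@heis_lattice_iE _ _ n).
have modelE s : G (screw s) ->
    G = generated (@heis_incl R @` heis_lattice 'i%C c `|` [set screw s]).
  by move=> Gs; rewrite latE -GL; exact: generated_heis_subset.
split; first by rewrite NE mul2n odd_double.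
have shift (q : int) s : t = c * q%:~R + s -> G (screw s).
  move=> ts; have := GM _ _ (Gcentral (- q)) Gscrew; congr G.
  by rewrite transl_screw ts intrN mulrN addKr.
(* 4 t = c (2 j + 1) with j = 2 q or j = 2 q + 1, so that t - c q is c / 4 or
   3 c / 4. *)
have [q [jq|jq]] := int_parity j; [left|right]; exists x.
  by apply/modelE/(shift q); move: tj; rewrite jq !(intrD, intrM); lra.
by apply/modelE/(shift q); move: tj; rewrite jq !(intrD, intrM); lra.
Qed.
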